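(* Let $l \geq 1$ be an integer and run the reduction algorithm described in the context starting from $X_1(l) = X(l)$. Then for every $k \geq 1$ such that the sequence $X_k(l)$ is produced by the algorithm, $X_k(l)$ is $2^{n_k}$-simple for some positive integer $n_k$ (so that each step of the algorithm is well defined).
   Context: For integers $m \geq 1$ and $0 \leq l \leq m$ let $A_{l,m} = \frac{l!\, m!}{2^{m-l}} \sum_{k=l}^{m} 2^{k} \binom{2m-2k}{m-k}\binom{m+k}{m}\binom{k}{l}$ (these are integers; set $A_{0,0}=1$), and let $\nu_2$ denote the $2$-adic valuation. For $l \geq 0$ let $X(l)$ be the sequence $\big(\nu_2(A_{l,\,l+m-1})\big)_{m \geq 1}$. Operators on integer sequences: $F(a_1,a_2,a_3,\dots) = (a_1,a_1,a_2,a_3,\dots)$ and $T(a_1,a_2,a_3,\dots) = (a_1,a_3,a_5,a_7,\dots)$. Let $c = (\nu_2(m))_{m\geq 1} = (0,1,0,2,0,1,0,3,\dots)$. For an integer $s \geq 2$, a sequence $(a_j)_{j\geq 1}$ is called $s$-simple if $s$ is the largest integer such that $a_{st+1} = a_{st+2} = \cdots = a_{s(t+1)}$ for every $t \geq 0$. The reduction algorithm: set $X_1(l) = X(l)$. At cycle $k$, given $X_k(l)$, find $n_k \in \mathbb{N}$ such that $X_k(l)$ is $2^{n_k}$-simple; put $Y = T^{n_k}(X_k(l))$, $Z = Y - c$ (termwise difference), $W = F(Z)$. If $W$ is a constant sequence, stop; otherwise set $X_{k+1}(l) = W$ and perform the next cycle. *)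

(* Defs.v *)
From mathcomp Require Import all_boot all_order all_algebra.

Set Implicit Arguments.
Unset Strict Implicit.
Unset Printing Implicit Defensive.

Import Order.TTheory GRing.Theory Num.Theory.
Local Open Scope ring_scope.

(* Meaningful for [l <= m]; computed in [rat] so that the division by
   [2 ^ (m - l)] is exact.  [A 0 0] evaluates to 1. *)
Definition A (l m : nat) : rat :=
  (l`! * m`!)%N%:R / 2 ^+ (m - l)%N *
  \sum_(l <= k < m.+1)
     (2 ^ k * 'C(2 * m - 2 * k, m - k) * 'C(m + k, m) * 'C(k, l))%N%:R.

(* 2-adic valuation of a nonzero rational; junk value 0 at 0. *)
Definition nu2 (x : rat) : int :=
  (logn 2 `|numq x|%N)%:Z - (logn 2 `|denq x|%N)%:Z.

(* A sequence (a_1, a_2, a_3, ...) is represented by the function a with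
   a i = a_(i+1); all indices below are shifted accordingly. *)
Definition sequence := nat -> int.

Definition Xseq (l : nat) : sequence := fun i => nu2 (A l (l + i)).

Definition F (a : sequence) : sequence := fun i => a i.-1.

Definition T (a : sequence) : sequence := fun i => a (2 * i)%N.

Definition c : sequence := fun i => nu2 i.+1%:R.

Definition sub_termwise (a b : sequence) : sequence := fun i => a i - b i.

Definition block_constant (s : nat) (a : sequence) : Prop :=
  forall t i : nat, (i < s)%N -> a (s * t + i)%N = a (s * t)%N.

Definition simple (s : nat) (a : sequence) : Prop :=
  [/\ (2 <= s)%N,
      block_constant s a
    & forall s' : nat, block_constant s' a -> (s' <= s)%N].

Definition constant_sequence (a : sequence) : Prop :=
  exists z : int, forall i : nat, a i = z.

Definition cycle_output (n : nat) (X : sequence) : sequence :=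
  F (sub_termwise (iter n T X) c).

(* [produced l k X]: the algorithm started from [Xseq l] reaches cycle [k],
   and [X] is the sequence X_k(l) that this cycle starts from. *)
Inductive produced (l : nat) : nat -> sequence -> Prop :=
| produced_init : produced l 1 (Xseq l)
| produced_next (k n : nat) (X : sequence) :
    produced l k X ->
    simple (2 ^ n) X ->
    ~ constant_sequence (cycle_output n X) ->
    produced l k.+1 (cycle_output n X).

(* Main.v *)
Require Import Defs.
From mathcomp Require Import all_boot all_order all_algebra.
From mathcomp Require Import ring zify.

(** For fixed [m], the sums [E l = \sum_k e_k k^_l] with
    [e_k = 2^k 'C(2m-2k, m-k) 'C(m+k, m)] satisfy a three-term recurrence in [l].
    After dividing by [2^m (m+l)! / (m! (m-l)!)] it reads
    [B l = (2m+1) B (l+1) - (m-l-1)(m+l+2) B (l+2)], where the last coefficient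
    is even and [B m = 1]; hence all [B l] are odd and
    [nu2 (A l m) = l + nu2 ((m+l)! / (m-l)!)].

    So [X(l)] has the form [i |-> z + nu2 ((i+p)!) - nu2 (i!)] with [p = 2l].
    If [p = 2^n q] with [q] odd, such a sequence is [2^n]-simple, and one cycle
    of the algorithm turns it into a sequence of the same form with [p]
    replaced by the even number [q - 1]; it is constant exactly when [q = 1]. *)

Set Implicit Arguments.
Unset Strict Implicit.
Unset Printing Implicit Defensive.

Import Order.TTheory GRing.Theory Num.Theory.
Local Open Scope ring_scope.

(** * The valuation of [A l m] *)

Definition summand (m k : nat) : nat :=
  (2 ^ k * 'C(2 * m - 2 * k, m - k) * 'C(m + k, m))%N.

(** The falling factorial absorbs the factor [l!] of [A l m], as [k ^_ l] is [l!] times ['C(k, l)];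
    signed coefficients call for [int]. *)
Definition ffact_sum (m l : nat) : int :=
  \sum_(k < m.+1) (summand m k * k ^_ l)%N%:Z.

Lemma central_binS n :
  (n.+1 * 'C(2 * n.+1, n.+1) = 2 * (2 * n).+1 * 'C(2 * n, n))%N.
Proof.
have h1 : ((2 * n).+2 * 'C((2 * n).+1, n) = n.+1 * 'C((2 * n).+2, n.+1))%N
  by rewrite mul_bin_diag.
have h2 := mul_bin_down (2 * n).+1 n; rewrite /= in h2.
have e : ((2 * n).+1 - n = n.+1)%N by lia.
rewrite e in h2; have -> : (2 * n.+1 = (2 * n).+2)%N by lia.
by rewrite -h1 -mulnA h2; nia.
Qed.

(** Product of the ratios of consecutive values of the two binomials and of the power of 2, with
    denominators cleared. *)
Lemma summandS m k : (k < m)%N ->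
  (k.+1 * (2 * (m - k)).-1 * summand m k.+1
   = (m + k.+1) * (m - k) * summand m k)%N.
Proof.
move=> lt_km; pose n := (m - k.+1)%N.
have e1 : (m - k = n.+1)%N by rewrite /n; lia.
have e2 : (2 * m - 2 * k = 2 * n.+1)%N by lia.
have e3 : (2 * m - 2 * k.+1 = 2 * n)%N by lia.
have h := mul_bin_down (m + k.+1) m.
rewrite addKn addnS /= in h.
rewrite /summand e1 e2 e3 -/n expnS addnS.
transitivity ((2 * (2 * n).+1 * 'C(2 * n, n)) * (k.+1 * 'C((m + k).+1, m))
              * 2 ^ k)%N.
  have -> : (2 * n.+1).-1 = (2 * n).+1 by lia.
  by ring.
by rewrite -central_binS -h; ring.
Qed.

(* Multiply the first-order recurrence [summandS] by [k^_l] and sum over [k]. *)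
Lemma ffact_sum_shift m l :
  \sum_(k < m.+1) (m%:Z + k%:Z + 1) * (m%:Z - k%:Z) * (summand m k * k ^_ l)%N%:Z
  = \sum_(k < m.+1)
      (2 * m%:Z - 2 * k%:Z + 1) * (summand m k * k ^_ l.+1)%N%:Z :> int.
Proof.
(* The left term [k = m] vanishes through [m - k], the right term [k = 0] through [0 ^_ l.+1]; then
   [k] on the left pairs with [k.+1] on the right. *)
rewrite big_ord_recr /= subrr mulr0 mul0r addr0.
rewrite big_ord_recl /= ffact0n muln0 mulr0 add0r.
apply: eq_bigr => k _; rewrite /bump /= add1n ffactSS.
have hk := ltn_ord k; have /(congr1 Posz) := summandS hk.
rewrite !PoszM.
have -> : (2 * (m - k)).-1%:Z = 2 * m%:Z - 2 * k.+1%:Z + 1 :> int by lia.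
have -> : (m - k)%:Z = m%:Z - k%:Z :> int by lia.
have -> : (m + k.+1)%:Z = m%:Z + k%:Z + 1 :> int by lia.
move=> h.
by rewrite mulrA -h; ring.
Qed.

(** Once every falling factorial is reduced to [k ^_ l], this agrees term by term with
    [ffact_sum_shift]. *)
Lemma ffact_sum_rec m l :
  ffact_sum m l.+2 = (2 * m%:Z + 1) * ffact_sum m l.+1
                     - (m%:Z - l%:Z) * (m%:Z + l%:Z + 1) * ffact_sum m l.
Proof.
apply/eqP; rewrite -subr_eq0; apply/eqP.
have /eqP := ffact_sum_shift m l; rewrite -subr_eq0 => /eqP h.
rewrite -[RHS]h /ffact_sum !mulr_sumr -!sumrB; apply: eq_bigr => k _.
have hS (j : nat) : (k ^_ j.+1)%:Z = (k%:Z - j%:Z) * (k ^_ j)%:Z :> int.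
  rewrite ffactnSr; case: (leqP j k) => hj; first by rewrite PoszM -subzn // mulrC.
  by rewrite ffact_small // mulr0.
rewrite !(PoszM (summand m k)) !hS; have -> : l.+1%:Z = l%:Z + 1 :> int by lia.
by ring.
Qed.

Lemma ffact_sum_top m :
  ffact_sum m m * m`!%:Z = (2 ^ m)%N%:Z * (2 * m)`!%:Z.
Proof.
rewrite /ffact_sum big_ord_recr /= big1 ?add0r => [|k _]; last first.
  by rewrite ffact_small ?ltn_ord // muln0.
rewrite ffactnn /summand !subnn bin0 muln1 -!PoszM; congr Posz.
have h := bin_fact (leq_addr m m); rewrite addnK in h.
by rewrite mul2n -addnn -h; ring.
Qed.

Lemma ffact_sum_gt m l : (m < l)%N -> ffact_sum m l = 0.
Proof.
move=> lt_ml; rewrite /ffact_sum big1 // => k _.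
by rewrite ffact_small ?muln0 //; have := ltn_ord k; lia.
Qed.

Definition oddz (b : int) : bool := odd `|b|%N.

Lemma oddz_rec (b d : int) (m e : nat) : oddz b -> ~~ odd e ->
  oddz ((2 * m%:Z + 1) * b - e%:Z * d).
Proof.
rewrite /oddz => odd_b even_e.
have [b' ->] : exists b' : int, b = 2 * b' + 1 by exists (b %/ 2)%Z; lia.
have [f ->] : exists f : nat, e = (2 * f)%N by exists e./2; lia.
have -> : (2 * m%:Z + 1) * (2 * b' + 1) - (2 * f)%N%:Z * d
          = 2 * (2 * m%:Z * b' + m%:Z + b' - f%:Z * d) + 1
  by rewrite PoszM; ring.
by lia.
Qed.

(** One downward step of the recurrence, at [l = m - j.+2], for abstract values of the sums already
    multiplied by [m!]. *)
Lemma ffact_sum_odd_step m j (E0 E1 E2 b0 b1 : int) :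
  (j.+2 <= m)%N ->
  E0 * j`!%:Z = (2 * m - j)`!%:Z * b0 ->
  E1 * j.+1`!%:Z = (2 * m - j.+1)`!%:Z * b1 ->
  E0 = (2 * m%:Z + 1) * E1 - j.+2%:Z * (2 * m - j.+1)%N%:Z * E2 ->
  E2 * j.+2`!%:Z = (2 * m - j.+2)`!%:Z
                   * ((2 * m%:Z + 1) * b1 - (j.+1 * (2 * m - j))%N%:Z * b0).
Proof.
move=> le_jm h0 h1 hE.
pose w := (2 * m - j.+2)%N.
have e1 : (2 * m - j.+1 = w.+1)%N by rewrite /w; lia.
have e0 : (2 * m - j = w.+2)%N by rewrite /w; lia.
rewrite e0 in h0 *; rewrite e1 in h1 hE; rewrite -/w.
rewrite [j.+1`!]factS [j.+2`!]factS [w.+2`!]factS [w.+1`!]factS !PoszM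
  in h0 h1 *.
have w0 : w.+1%:Z != 0 :> int by [].
(* Multiplying by [w.+1], which is [2 * m - j.+1], completes the coefficient of [E2] in [hE], so
   nothing is divided. *)
apply: (mulfI w0).
transitivity (j.+1%:Z * j`!%:Z * (j.+2%:Z * w.+1%:Z * E2)); first by ring.
have -> : j.+2%:Z * w.+1%:Z * E2 = (2 * m%:Z + 1) * E1 - E0
  by rewrite hE; ring.
transitivity ((2 * m%:Z + 1) * (E1 * (j.+1%:Z * j`!%:Z))
              - j.+1%:Z * (E0 * j`!%:Z)); first by ring.
by rewrite h0 h1; ring.
Qed.

Lemma ffact_sum_odd m j : (j <= m)%N ->
  exists2 b : int, oddz b
  & ffact_sum m (m - j) * m`!%:Z * j`!%:Z
    = (2 * m - j)`!%:Z * ((2 ^ m)%N%:Z * b).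
Proof.
pose P j := exists2 b : int, oddz b
  & ffact_sum m (m - j) * m`!%:Z * j`!%:Z
    = (2 * m - j)`!%:Z * ((2 ^ m)%N%:Z * b).
(* The recurrence has order two, so the induction carries two consecutive values. *)
suff h : (j <= m)%N -> P j /\ ((j.+1 <= m)%N -> P j.+1) by move/h => [].
elim: j => [_|j IHj lt_jm].
  split=> [|lt_0m].
    exists 1 => //; rewrite !subn0 ffact_sum_top fact0 !mulr1; exact: mulrC.
  (* The sum at [m.+1] is zero, so the recurrence links the sums at [m - 1] and [m] alone and yields
     the witness [2m + 1]. *)
  have := ffact_sum_rec m m.-1.
  rewrite prednK // ffact_sum_gt // => h.
  exists (2 * m%:Z + 1); first by rewrite /oddz; lia.
  have htop := ffact_sum_top m.
  have e : (2 * m)`! = (2 * m * (2 * m - 1)`!)%N.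
    by rewrite -[in LHS](@prednK (2 * m)) ?factS ?subn1 ?prednK //; lia.
  have m0 : (2 * m)%N%:Z != 0 :> int by lia.
  apply: (mulfI m0).
  have hE : (2 * m)%N%:Z * ffact_sum m (m - 1)
            = (2 * m%:Z + 1) * ffact_sum m m.
    move: h; rewrite -subn1.
    have -> : (m%:Z - (m - 1)%N%:Z) = 1 :> int by lia.
    have -> : (m%:Z + (m - 1)%N%:Z + 1) = (2 * m)%N%:Z :> int by lia.
    by rewrite mul1r => /esym/eqP; rewrite subr_eq0 => /eqP ->.
  rewrite (_ : 1`! = 1%N) // mulr1 [LHS]mulrA hE -[LHS]mulrA htop e PoszM; ring.
have [[b0 odd0 h0] /(_ lt_jm) [b1 odd1 h1]] := IHj (ltnW lt_jm).
split=> [|lt_j2m]; first by exists b1.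
exists ((2 * m%:Z + 1) * b1 - (j.+1 * (2 * m - j))%N%:Z * b0).
  (* [j.+1] and [2 * m - j] have opposite parities, so their product is even. *)
  by apply: oddz_rec => //; rewrite oddM oddB; lia.
have := @ffact_sum_odd_step m j (ffact_sum m (m - j) * m`!%:Z)
  (ffact_sum m (m - j.+1) * m`!%:Z) (ffact_sum m (m - j.+2) * m`!%:Z)
  _ _ lt_j2m h0 h1.
move=> ->; first by ring.
have := ffact_sum_rec m (m - j.+2).
have -> : ((m - j.+2).+2 = m - j)%N by lia.
have -> : ((m - j.+2).+1 = m - j.+1)%N by lia.
have -> : (m%:Z - (m - j.+2)%N%:Z) = j.+2%:Z :> int by lia.
have -> : (m%:Z + (m - j.+2)%N%:Z + 1) = (2 * m - j.+1)%N%:Z :> int by lia.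
by move=> ->; ring.
Qed.

(** Cross-multiplication frees the valuation from the reduced fraction used in [nu2]. *)
Lemma nu2_quotient (x : rat) (u d : int) : u != 0 -> d != 0 ->
  x * d%:~R = u%:~R ->
  nu2 x = (logn 2 `|u|%N)%:Z - (logn 2 `|d|%N)%:Z.
Proof.
move=> u0 d0 hx.
have x0 : x != 0.
  by apply: contraNneq u0 => x0; move: hx; rewrite x0 mul0r => /esym/eqP;
     rewrite intr_eq0.
have h : numq x * d = u * denq x.
  apply: (@intr_inj rat); rewrite !intrM -hx.
  by rewrite numqE; ring.
have /(congr1 (logn 2)) : (`|numq x| * `|d| = `|u| * `|denq x|)%N
  by rewrite -!abszM h.
rewrite !lognM ?absz_gt0 ?numq_eq0 ?denq_neq0 // /nu2.
lia.
Qed.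

Lemma A_ffact_sum l i :
  A l (l + i) * (2 ^ i)%N%:R = ((l + i)`!%:Z * ffact_sum (l + i) l)%:~R.
Proof.
rewrite /A addKn natrX.
have t0 : (2 : rat) ^+ i != 0 by rewrite expf_neq0.
(* The sum may start at 0, since ['C(k, l)] vanishes for [k < l]. *)
rewrite [X in _ / _ * X](_ : _ = \sum_(k < (l + i).+1)
   (2 ^ k * 'C(2 * (l + i) - 2 * k, (l + i) - k) * 'C((l + i) + k, l + i)
    * 'C(k, l))%N%:R); last first.
  rewrite -(big_mkord xpredT (fun k => (2 ^ k * 'C(2 * (l + i) - 2 * k, (l + i) - k)
    * 'C((l + i) + k, l + i) * 'C(k, l))%N%:R)).
  rewrite [RHS](big_cat_nat (n := l)) //=; last by lia.
  rewrite [X in _ = X + _]big_nat_cond [X in _ = X + _]big1 ?add0r // => k /andP[/andP[_ hk] _].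
  by rewrite (bin_small hk) muln0.
rewrite mulrAC divfK // /ffact_sum intrM rmorph_sum /= natrM.
rewrite mulrAC [LHS]mulrC mulr_sumr; congr (_ * _).
by apply: eq_bigr => k _; rewrite /summand -natrM -bin_ffact; congr (_%:R); ring.
Qed.

Lemma logn2_odd n : odd n -> logn 2 n = 0%N.
Proof. by move=> odd_n; rewrite lognE dvdn2 odd_n !andbF. Qed.

Lemma nu2_A l i :
  nu2 (A l (l + i))
  = l%:Z + (logn 2 (i + 2 * l)`!)%:Z - (logn 2 i`!)%:Z.
Proof.
set m := (l + i)%N.
have le_im : (i <= m)%N by rewrite /m; lia.
have [b odd_b hb] := ffact_sum_odd le_im.
have el : (m - i = l)%N by rewrite /m; lia.
have ew : (2 * m - i = i + 2 * l)%N by rewrite /m; lia.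
rewrite el ew in hb.
have b0 : b != 0 by apply: contraTneq odd_b => ->.
pose u : int := (2 ^ m * (i + 2 * l)`!)%N%:Z * b.
have hx : A l m * (2 ^ i * i`!)%N%:Z%:~R = u%:~R.
  rewrite PoszM intrM mulrA A_ffact_sum -intrM; congr (_%:~R).
  by rewrite /u [m`!%:Z * _]mulrC hb PoszM; ring.
have u0 : u != 0.
  by rewrite /u mulf_neq0 //; apply/eqP; case; apply/eqP;
     rewrite -lt0n muln_gt0 expn_gt0 fact_gt0.
have d0 : (2 ^ i * i`!)%N%:Z != 0 :> int.
  by apply/eqP; case; apply/eqP; rewrite -lt0n muln_gt0 expn_gt0 fact_gt0.
rewrite (nu2_quotient u0 d0 hx) /u abszM !absz_nat.
rewrite !lognM ?muln_gt0 ?expn_gt0 ?fact_gt0 ?absz_gt0 // !pfactorK //.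
by rewrite (logn2_odd odd_b) /m; lia.
Qed.

(** * Sequences of differences of factorial valuations *)

Definition fact_diff (p : nat) (z : int) (X : sequence) : Prop :=
  forall i, X i = z + (logn 2 (i + p)`!)%:Z - (logn 2 i`!)%:Z.

Lemma logn2_factS n : logn 2 n.+1`! = (logn 2 n.+1 + logn 2 n`!)%N.
Proof. by rewrite factS lognM // fact_gt0. Qed.

Lemma logn2_fact_doubleS n : logn 2 (2 * n).+1`! = logn 2 (2 * n)`!.
Proof. by rewrite logn2_factS logn2_odd //; lia. Qed.

Lemma logn2_fact_double n : logn 2 (2 * n)`! = (logn 2 n`! + n)%N.
Proof.
elim: n => [|n IHn]; first by rewrite muln0.
have e : (2 * n.+1 = (2 * n).+2)%N by lia.
rewrite e logn2_factS logn2_fact_doubleS IHn logn2_factS -e lognM //.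
rewrite (_ : logn 2 2 = 1%N) //; lia.
Qed.

(** Doubling adds [i + p] to one valuation and [i] to the other; only the constant [p] remains. *)
Lemma fact_diff_T p z X :
  fact_diff (2 * p) z X -> fact_diff p (z + p%:Z) (T X).
Proof.
move=> hX i; rewrite /T hX -mulnDr !logn2_fact_double; lia.
Qed.

Lemma fact_diff_pair p z X : fact_diff (2 * p) z X ->
  forall i, X (2 * i).+1 = X (2 * i)%N.
Proof.
by move=> hX i; rewrite !hX addSn -mulnDr !logn2_fact_doubleS.
Qed.

Lemma fact_diff_pow n q z X : fact_diff (2 ^ n * q) z X ->
  block_constant (2 ^ n) X /\ exists z', fact_diff q z' (iter n T X).
Proof.
elim: n z X => [|n IHn] z X hX.
  split; first by move=> t [|i] //; rewrite addn0.
  by exists z; rewrite expn0 mul1n in hX.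
rewrite expnS -mulnA in hX.
have [hb [z' hz']] := IHn _ _ (fact_diff_T hX).
split; last by exists z'; rewrite iterSr.
move=> t i lt_i; rewrite expnS in lt_i *.
(* Entries agree in pairs, so [i] may be rounded down to an even index, where [X] is read off from
   [T X]. *)
have -> : X (2 * 2 ^ n * t + i)%N = X (2 * (2 ^ n * t + i./2))%N.
  have {1}-> : i = (i./2.*2 + odd i)%N by rewrite addnC odd_double_half.
  have -> : (2 * 2 ^ n * t + (i./2.*2 + odd i)
             = odd i + 2 * (2 ^ n * t + i./2))%N by lia.
  by case: (odd i); rewrite // add1n (fact_diff_pair hX).
by rewrite -mulnA; apply: (hb t i./2); lia.
Qed.

Lemma iter_T n (X : sequence) i : iter n T X i = X (2 ^ n * i)%N.
Proof.
elim: n i => [|n IHn] i /=; first by rewrite mul1n.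
by rewrite /T IHn expnS; congr X; lia.
Qed.

Lemma fact_diff_simple n q z X : (0 < n)%N -> odd q ->
  fact_diff (2 ^ n * q) z X -> simple (2 ^ n) X.
Proof.
move=> n_gt0 odd_q hX; have [hb [z' hz']] := fact_diff_pow hX.
split=> // [|s hs]; first by rewrite -{1}(expn1 2) leq_exp2l.
rewrite leqNgt; apply/negP => lt_s.
(* Otherwise the first two blocks agree, so [q + 1] would be odd. *)
have := hs 0%N _ lt_s; rewrite muln0 add0n.
have := hz' 1%N; have := hz' 0%N; rewrite !iter_T muln0 muln1 => -> ->.
rewrite add0n add1n logn2_factS.
suff : (0 < logn 2 q.+1)%N by rewrite (_ : logn 2 1`! = 0%N) //; lia.
by rewrite logn_gt0 mem_primes /= dvdn2 /= odd_q.
Qed.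

(** Identifies the exponent chosen in [produced] with the 2-adic valuation of the shift. *)
Lemma simple_pow_inj m n X : simple (2 ^ m) X -> simple (2 ^ n) X -> m = n.
Proof.
move=> [_ bm maxm] [_ bn maxn].
by apply/eqP; rewrite -(eqn_exp2l _ _ (ltnSn 1)) eqn_leq maxn // maxm.
Qed.

(** * The effect of a cycle and the invariant of the algorithm *)

Lemma c_logn i : c i = (logn 2 i.+1)%:Z.
Proof.
rewrite /c (@nu2_quotient _ i.+1%:Z 1) ?mulr1 //=.
by rewrite logn1 subr0.
Qed.

(** Subtracting [c] turns [i!] into [(i+1)!]; the delay by [F] then restores [i!] and lowers [q] by
    one. *)
Lemma cycle_output_fact_diff n q z X : odd q ->
  fact_diff (2 ^ n * q) z X -> exists z', fact_diff q.-1 z' (cycle_output n X).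
Proof.
move=> odd_q hX; have [_ [z' hz']] := fact_diff_pow hX.
exists z' => -[|i]; rewrite /cycle_output /F /sub_termwise hz' c_logn /=.
  (* The entry repeated by [F] fits because [q!] and [(q-1)!] have the same valuation for odd
     [q]. *)
  case: q odd_q {hX hz'} => // q odd_q.
  by rewrite !add0n /= logn2_factS (logn2_odd odd_q) logn1 subr0.
have -> : (i.+1 + q.-1 = i + q)%N by case: q odd_q {hX hz'} => // q _; rewrite addSnnS.
rewrite logn2_factS; lia.
Qed.

Lemma even_pow2_odd p : (0 < p)%N -> ~~ odd p ->
  exists n q, [/\ (0 < n)%N, odd q & p = (2 ^ n * q)%N].
Proof.
move=> p_gt0 even_p; have [q co_q ep] := pfactor_coprime (isT : prime 2) p_gt0.
exists (logn 2 p), q; split; last by rewrite mulnC.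
  by rewrite logn_gt0 mem_primes p_gt0 /= dvdn2.
by rewrite -coprime2n.
Qed.

Lemma produced_fact_diff l k X : (1 <= l)%N -> produced l k X ->
  exists p z, [/\ (0 < p)%N, ~~ odd p & fact_diff p z X].
Proof.
move=> l_gt0; elim=> [|{}k n {}X _ [p [z [p_gt0 even_p hX]]] simX nconst].
  by exists (2 * l)%N, l%:Z; split; [lia | lia | move=> i; apply: nu2_A].
have [n' [q [n'_gt0 odd_q ep]]] := even_pow2_odd p_gt0 even_p.
rewrite ep in hX.
have en := simple_pow_inj simX (fact_diff_simple n'_gt0 odd_q hX).
rewrite -en in hX.
have [z' hz'] := cycle_output_fact_diff odd_q hX.
exists q.-1, z'; split=> //; last by case: q odd_q {ep hX hz'}.
(* A zero shift would make the output constant, and the algorithm would have stopped. *)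
rewrite lt0n; apply/eqP => q0; apply: nconst; exists z' => i.
by rewrite hz' q0 addn0 addrK.
Qed.

Theorem theorem1p3 (l : nat) (hl : (1 <= l)%N) (k : nat) (hk : (1 <= k)%N)
    (X : sequence) (hX : produced l k X) :
  exists n : nat, (0 < n)%N /\ simple (2 ^ n) X.
Proof.
have [p [z [p_gt0 even_p hp]]] := produced_fact_diff hl hX.
have [n [q [n_gt0 odd_q ep]]] := even_pow2_odd p_gt0 even_p.
exists n; split=> //; rewrite ep in hp.
exact: fact_diff_simple n_gt0 odd_q hp.
Qed.
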